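(* Let $G$ be a complete multipartite graph with independence number $m\geq 2$. Suppose there are a partition $\Pi=\{\underline{X}_{m-1},\underline{X}_{m-2},\ldots,\underline{X}_{1},\overline{X}_{2},\ldots,\overline{X}_{m}\}$ of the parts of $G$ (of the kind described in the context) and a function $f:V(G)\rightarrow\mathbb{N}$ such that, with $F,S,\alpha,\beta$ and $\ell_j$ as defined in the context from $(\Pi,f)$: (R1) $F(j)\geq \alpha(j)+\beta(j)$ for all $j=1,\ldots,m$; and (R2) $\displaystyle f(v)\geq S(m-j)+\sum_{p=1}^{j-1}|V(\underline{X}_p)|+\sum_{q=1}^{i-1}|V(\underline{X}_{j,q})|+1$ for all $v\in V(\underline{X}_{j,i})$, for all $j=1,\ldots,m-1$ and $1\leq i\leq \ell_j$. Then $G$ is on-line $f$-choosable.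
   Context: All graphs are finite and simple. The parts of a complete multipartite graph are its partite sets (maximal independent sets); the independence number is the largest size of a part. On-line $f$-list coloring game. Given a graph $G$ and an integer-valued function $f$ on $V(G)$, two players Alice and Bob play as follows. Initially all vertices are uncolored. In round $i$, Alice marks a nonempty subset $V_i$ of the remaining uncolored vertices (assigning color $i$ as a permissible color to each vertex of $V_i$); then Bob chooses an independent set $X_i\subseteq V_i$ and colors all vertices of $X_i$ with color $i$. If at the end of some round there is a vertex $v$ that has been marked $f(v)$ times but is not yet colored, Alice wins. Otherwise Bob wins, i.e. in the end each vertex $v$ is colored by Bob before running out of $f(v)$ permissible colors. $G$ is on-line $f$-choosable if Bob has a winning strategy. Partition $\Pi$. The set of parts of $G$ is partitioned into families $\underline{X}_{m-1},\ldots,\underline{X}_{1},\overline{X}_{2},\ldots,\overline{X}_{m}$ (some possibly empty), where for $2\leq p\leq m$ every part in $\overline{X}_p$ has size exactly $p$, and for $1\leq p\leq m-1$ every part in $\underline{X}_p$ has size at most $p$. Put $u_p=|\overline{X}_p|$ and $\ell_p=|\underline{X}_p|$ (numbers of parts). Each family $\underline{X}_p$ is ordered: $\underline{X}_p=(\underline{X}_{p,1},\ldots,\underline{X}_{p,\ell_p})$, where $\underline{X}_{p,i}$ is the $i$th part. $V(\cdot)$ denotes the set of vertices in a part or in a family of parts. For $y=1,\ldots,m$, $$F(y)=\min\Big\{\sum_{v\in Y}f(v): Y\subseteq X\text{ for some part } X\in\bigcup_{p=2}^m\overline{X}_p,\ |Y|=y\Big\},$$ with the convention that the minimum over the empty set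 is $+\infty$. For $j=1,\ldots,m$, $$S(j)=\sum_{p=2}^{j}u_p+\sum_{p=\max(j+1,2)}^m(p-j)u_p.$$ $\alpha(1)=\sum_{p=2}^m u_p$, $\beta(1)=0$, and for $j=2,\ldots,m$, $$\alpha(j)=\alpha(j-1)+S(j-1),\qquad \beta(j)=\beta(j-1)+\sum_{p=1}^{m-j+1}|V(\underline{X}_p)|.$$ Empty sums are $0$. *)

(* Defs.v *)
(* [constructive_ereal] provides the value +oo of a minimum over the empty set. *)
From HB Require Import structures.
From mathcomp Require Import all_boot all_order all_algebra.
From mathcomp Require Import constructive_ereal.

Set Implicit Arguments.
Unset Strict Implicit.
Unset Printing Implicit Defensive.

Definition simple_graph (T : finType) (e : rel T) : Prop :=
  symmetric e /\ irreflexive e.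

Definition independent (T : finType) (e : rel T) (A : {set T}) : bool :=
  [forall x in A, forall y in A, ~~ e x y].

Definition independence_number (T : finType) (e : rel T) : nat :=
  \max_(A : {set T} | independent e A) #|A|.

Definition complete_multipartite (T : finType) (e : rel T) : Prop :=
  exists2 P : {set {set T}}, partition P [set: T] &
    forall x y, e x y = (pblock P x != pblock P y).

Definition parts (T : finType) (e : rel T) : {set {set T}} :=
  [set A | maxset (independent e) A].

(* A round is the pair (V_i, X_i) of the set marked by Alice and the set
   colored by Bob; a history lists the rounds played so far, oldest first. *)
Definition history (T : finType) : Type := seq ({set T} * {set T}).

Definition uncolored (T : finType) (h : history T) : {set T} :=
  ~: \bigcup_(r <- h) r.2.

Definition marks (T : finType) (h : history T) (v : T) : nat :=
  count (fun r : {set T} * {set T} => v \in r.1) h.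

Definition alice_move (T : finType) (h : history T) (V : {set T}) : bool :=
  (V != set0) && (V \subset uncolored h).

Definition bob_move (T : finType) (e : rel T) (V X : {set T}) : bool :=
  (X \subset V) && independent e X.

Definition alice_wins (T : finType) (f : T -> nat) (h : history T) : bool :=
  [exists v in uncolored h, f v <= marks h v].

(* Bob's answer, as a function of the rounds already completed and of the set
   that Alice has just marked. *)
Definition strategy (T : finType) : Type := history T -> {set T} -> {set T}.

Inductive played_by (T : finType) (s : strategy T) : history T -> Prop :=
| played_start : played_by s [::]
| played_round (h : history T) (V : {set T}) :
    played_by s h -> alice_move h V -> played_by s (rcons h (V, s h V)).

(* As long as Alice has not won, every uncolored vertex v has been marked fewer
   than f v times; hence no play against a winning strategy is infinite, and it
   can only stop when Alice has nothing left to mark, i.e. when all vertices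
   are colored. *)
Definition winning (T : finType) (e : rel T) (f : T -> nat) (s : strategy T) :
    Prop :=
  forall (h : history T) (V : {set T}), played_by s h -> alice_move h V ->
    bob_move e V (s h V) /\ ~~ alice_wins f (rcons h (V, s h V)).

Definition online_choosable (T : finType) (e : rel T) (f : T -> nat) : Prop :=
  exists s : strategy T, winning e f s.

(* [over p] is the family of the X-overline_p, relevant for 2 <= p <= m, and
   [under p] the ordered family of the X-underline_p, relevant for
   1 <= p <= m - 1; the values at other indices are never used. The first
   clause says that the families, listed one after the other, contain each part
   of the graph exactly once. *)
Definition is_partition_of_parts (T : finType) (e : rel T) (m : nat)
    (under : nat -> seq {set T}) (over : nat -> {set {set T}}) : Prop :=
  [/\ perm_eq ([seq A | p <- index_iota 1 m, A <- under p] ++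
               [seq A | p <- index_iota 2 m.+1, A <- enum (over p)])
              (enum (parts e)),
      forall p, 2 <= p <= m -> forall A, A \in over p -> #|A| = p &
      forall p, 1 <= p <= m.-1 -> forall A, A \in under p -> #|A| <= p].

Definition verts (T : finType) (s : seq {set T}) : {set T} :=
  \bigcup_(A <- s) A.

(* The parts of a family are numbered from 1. *)
Definition under_part (T : finType) (under : nat -> seq {set T}) (j i : nat) :
    {set T} :=
  nth set0 (under j) i.-1.

Definition Fmin (T : finType) (m : nat) (over : nat -> {set {set T}})
    (f : T -> nat) (y : nat) : \bar int :=
  \big[mine/+oo%E]_(Y : {set T} |
      (#|Y| == y) &&
      [exists X in \bigcup_(2 <= p < m.+1) over p, Y \subset X])
    ((\sum_(v in Y) f v)%N%:Z)%:E%E.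

Definition S_ (T : finType) (m : nat) (over : nat -> {set {set T}}) (j : nat) :
    nat :=
  \sum_(2 <= p < j.+1) #|over p| +
  \sum_(maxn j.+1 2 <= p < m.+1) (p - j) * #|over p|.

(* [alpha] and [beta] are meaningful from index 1 on; their value at 0 is
   irrelevant. *)
Fixpoint alpha (T : finType) (m : nat) (over : nat -> {set {set T}}) (j : nat) :
    nat :=
  if j is i.+1 then
    if i is 0 then \sum_(2 <= p < m.+1) #|over p|
    else alpha m over i + S_ m over i
  else 0.

Fixpoint beta (T : finType) (m : nat) (under : nat -> seq {set T}) (j : nat) :
    nat :=
  if j is i.+1 then
    if i is 0 then 0
    else beta m under i + \sum_(1 <= p < (m - j + 1).+1) #|verts (under p)|
  else 0.

(* Main.v *)
(* The position is kept as a list of "over" parts and an ordered list of "under"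
   parts, and Bob preserves (R1) and (R2) for the remaining graph and the
   remaining numbers of marks.  Let Alice mark V.
   - If an over part is contained in V, Bob colors it: alpha(y) drops by at
     least y.
   - Otherwise, if equality in (R1) holds for some Y included in V, take such a
     Y of maximal size y in an over part X.  Bob colors X :&: V, and X :\: V
     becomes the last under part of level m - y: tightness of Y and (R1) for
     v |: Y give f(v) >= (alpha + beta)(y+1) - (alpha + beta)(y), which is
     what (R2) demands there.
   - Otherwise every Y in an over part is short of (R1) by less than #|Y| after
     the marking.  If coloring the marked vertices of the first marked under
     part restores (R1), Bob does so.  If not, among the sets Y whose deficit it
     does not cover, take one of maximal size and then of maximal deficit, in an
     over part X.  Bob colors X :&: V and keeps X :\: V as an over part, or
     puts it first at level 1 if it is a singleton.  As #|X| >= #|Y| is large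
     compared with the level of every marked under part, S(m-j) drops by enough
     for (R2) at those levels. *)
Require Import Defs.
From HB Require Import structures.
From mathcomp Require Import all_boot all_order all_algebra.
From mathcomp Require Import constructive_ereal boolp zify.

Set Implicit Arguments.
Unset Strict Implicit.
Unset Printing Implicit Defensive.

(** * Costs, requirements and Bob's invariant *)

(* The contributions of a part of size p to S(j) and to alpha(y). *)
Definition scost (p j : nat) : nat := maxn 1 (p - j).

Definition acost (p y : nat) : nat := 1 + \sum_(1 <= i < y) scost p i.

Definition Ssum (T : finType) (O : seq {set T}) (j : nat) : nat :=
  \sum_(A <- O) scost #|A| j.

Definition weight (T : finType) (L : seq ({set T} * nat)) : nat :=
  \sum_(x <- L) #|x.1|.

(* alpha(y) + beta(y); in L, every under part comes with the index j of its
   family, and is counted in beta(i) - beta(i-1) for 2 <= i <= m - j + 1. *)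
Definition req (T : finType) (m : nat) (O : seq {set T})
    (L : seq ({set T} * nat)) (y : nat) : nat :=
  \sum_(A <- O) acost #|A| y + \sum_(x <- L) #|x.1| * minn y.-1 (m - x.2).

(* (R2) for a list of under parts preceded by parts of total size acc, with
   c j in place of S(m-j). *)
Fixpoint demand (T : finType) (c : nat -> nat) (g : T -> nat) (acc : nat)
    (L : seq ({set T} * nat)) : Prop :=
  if L is x :: L' then
    (forall v, v \in x.1 -> c x.2 + acc < g v) /\
    demand c g (acc + #|x.1|) L'
  else True.

Definition spend (T : finType) (V : {set T}) (g : T -> nat) (v : T) : nat :=
  g v - (v \in V).

(* The parts may overlap and may contain colored vertices: only their covering
   the set R of uncolored vertices matters. *)
Definition good (T : finType) (e : rel T) (m : nat) (R : {set T})
    (g : T -> nat) (O : seq {set T}) (L : seq ({set T} * nat)) : Prop :=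
  [/\ forall A : {set T}, A \in O -> independent e A /\ 2 <= #|A| <= m,
      forall x : {set T} * nat, x \in L -> independent e x.1 /\ 0 < x.2,
      pairwise leq (unzip2 L),
      forall v, v \in R ->
        (exists2 A, A \in O & v \in A) \/ (exists2 x, x \in L & v \in x.1) &
      (forall A Y : {set T}, A \in O -> Y \subset A -> Y != set0 ->
         req m O L #|Y| <= \sum_(v in Y) g v) /\
      demand (fun q => Ssum O (m - q)) g 0 L].

(** * Estimates on the costs *)

Lemma acostS p y : 0 < y -> acost p y.+1 = acost p y + scost p y.
Proof. by move=> y0; rewrite /acost big_nat_recr //= addnA. Qed.

Lemma acost1 p : acost p 1 = 1.
Proof. by rewrite /acost big_geq. Qed.

Lemma acost_ge p y : 0 < y -> y <= acost p y.
Proof.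
elim: y => // -[_ _|y IH _]; first by rewrite acost1.
by rewrite acostS // /scost; have := IH isT; lia.
Qed.

(** Here p = [#|X|], k = [#|X :&: V|] and y0 is the size of the tight set: dropping X must pay for y
    marks and for [X :\: V] as an under part of level m - y0. Term by term, [scost p i] is at least
    p - k + 1 for i < y0 and can be one short only at i = y0; hence the boolean. *)
Lemma acost_tight p k y0 y : k <= p -> 0 < y0 <= k -> 0 < y ->
  (p - k) * minn y.-1 y0 + y <= acost p y + (y0 < y).
Proof.
move=> kp y0k; elim: y => // -[_ _|y IH _]; first by rewrite acost1; lia.
have := IH isT; rewrite (acostS _ (ltn0Sn y)) /scost.
rewrite ![_.+1.-1]/=.
case: (ltnP y y0) => H.
  have -> : minn y.+1 y0 = y.+1 by lia.
  rewrite mulnS; lia.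
have -> : minn y.+1 y0 = y0 by lia.
lia.
Qed.

(** For i <= p - 2, replacing p by p - k lowers [scost p i] by at least 1; at i = 1 it lowers it by
    k when p - k >= 2, whence the bracketed extra unit. *)
Lemma acost_shrink p k y : 0 < k < p ->
  acost (p - k) y.+1 + minn y (p - 2) + [&& 1 < k, k.+1 < p & 0 < y]
  <= acost p y.+1.
Proof.
move=> kp; elim: y => [|y IH]; first by rewrite !acost1; lia.
rewrite (acostS _ (ltn0Sn y)) (acostS p (ltn0Sn y)) /scost.
move: IH; case: y => [|y]; rewrite ?acost1; lia.
Qed.

(** * Bookkeeping for marks, demands and requirements *)

Lemma demand_cat (T : finType) c (g : T -> nat) acc L1 L2 :
  demand c g acc (L1 ++ L2) <->
  demand c g acc L1 /\ demand c g (acc + weight L1) L2.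
Proof.
elim: L1 acc => [|x L1 IH] acc /=.
  by rewrite /weight big_nil addn0; tauto.
rewrite IH /weight big_cons addnA; tauto.
Qed.

Lemma demand_mono (T : finType) c c' (g g' : T -> nat) acc acc'
    (L : seq ({set T} * nat)) :
  (forall x v, x \in L -> v \in x.1 ->
     c' x.2 + acc' + g v <= c x.2 + acc + g' v) ->
  demand c g acc L -> demand c' g' acc' L.
Proof.
elim: L acc acc' => //= x L IH acc acc' H [H1 H2]; split.
  move=> v vx; have := H1 v vx; have := H x v (mem_head _ _) vx; lia.
apply: IH H2 => z v zL vz.
have /H/(_ vz) : z \in x :: L by rewrite inE zL orbT.
lia.
Qed.

Lemma sum_spend (T : finType) (V Y : {set T}) (g : T -> nat) :
  \sum_(v in Y) g v <= \sum_(v in Y) spend V g v + #|Y :&: V|.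
Proof.
have -> : #|Y :&: V| = \sum_(v in Y | v \in V) 1.
  by rewrite -sum1_card; apply: eq_bigl => v; rewrite inE.
rewrite big_mkcondr -big_split /=; apply: leq_sum => v _.
by rewrite /spend; case: (v \in V); lia.
Qed.

Lemma spend_unmarked (T : finType) (V : {set T}) (g : T -> nat) v :
  v \notin V -> spend V g v = g v.
Proof. by rewrite /spend => /negPf->; rewrite subn0. Qed.

Lemma spend_le (T : finType) (V : {set T}) (g : T -> nat) v :
  g v <= spend V g v + (v \in V).
Proof. by rewrite /spend; case: (v \in V); lia. Qed.

Lemma independentS (T : finType) (e : rel T) (A B : {set T}) :
  A \subset B -> independent e B -> independent e A.
Proof.
move=> /subsetP AB /forall_inP H; apply/forall_inP => x /AB/H/forall_inP Hx.
by apply/forall_inP => y /AB/Hx.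
Qed.

Lemma independent_diff (T : finType) (e : rel T) (A B : {set T}) :
  independent e A -> independent e (A :\: B).
Proof. by apply: independentS; apply: subsetDl. Qed.

Lemma independent_meet (T : finType) (e : rel T) (A B : {set T}) :
  independent e A -> independent e (A :&: B).
Proof. by apply: independentS; apply: subsetIl. Qed.

Lemma Ssum_rem (T : finType) (O : seq {set T}) X j : X \in O ->
  Ssum O j = scost #|X| j + Ssum (rem X O) j.
Proof. by move=> XO; rewrite /Ssum (big_rem X). Qed.

Lemma req_rem (T : finType) m (O : seq {set T}) L X y : X \in O ->
  req m O L y = acost #|X| y + req m (rem X O) L y.
Proof. by move=> XO; rewrite /req (big_rem X) //= -addnA. Qed.

Lemma req_split (T : finType) m (O : seq {set T}) L1 x L2 y :
  req m O (L1 ++ x :: L2) y =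
  #|x.1| * minn y.-1 (m - x.2) + req m O (L1 ++ L2) y.
Proof. by rewrite /req !big_cat big_cons /=; lia. Qed.

Lemma req1 (T : finType) m (O : seq {set T}) L : req m O L 1 = size O.
Proof.
rewrite /req (eq_bigr (fun=> 1)) => [|A _]; last exact: acost1.
rewrite sum1_size [X in _ + X]big1 ?addn0 // => x _.
by rewrite min0n muln0.
Qed.

(** The recursions of alpha and beta in one: an under part of level q contributes to the increment
    exactly when y <= m - q. *)
Lemma req_succ (T : finType) m (O : seq {set T}) (L1 L2 : seq ({set T} * nat))
    y :
  0 < y <= m ->
  (forall x : {set T} * nat, x \in L1 -> x.2 <= m - y) ->
  (forall x : {set T} * nat, x \in L2 -> m - y < x.2) ->
  req m O (L1 ++ L2) y.+1 = req m O (L1 ++ L2) y + Ssum O y + weight L1.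
Proof.
move=> /andP[y0 ym] H1 H2; rewrite /req /Ssum /weight !big_cat /=.
have -> : \sum_(A <- O) acost #|A| y.+1 =
          \sum_(A <- O) acost #|A| y + \sum_(A <- O) scost #|A| y.
  by rewrite -big_split; apply: eq_bigr => A _; rewrite /= acostS.
have -> : \sum_(x <- L1) #|x.1| * minn y (m - x.2) =
          \sum_(x <- L1) #|x.1| * minn y.-1 (m - x.2) + \sum_(x <- L1) #|x.1|.
  rewrite -big_split /= !big_seq; apply: eq_bigr => -[A q] /H1 /= qm.
  have [-> ->] : minn y (m - q) = y.-1.+1 /\ minn y.-1 (m - q) = y.-1.
    by split; lia.
  by rewrite mulnSr.
have -> : \sum_(x <- L2) #|x.1| * minn y (m - x.2) =
          \sum_(x <- L2) #|x.1| * minn y.-1 (m - x.2).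
  by rewrite !big_seq; apply: eq_bigr => -[A q] /H2 /= qm; congr (_ * _); lia.
lia.
Qed.

Lemma level_split (T : finType) (L : seq ({set T} * nat)) q :
  pairwise leq (unzip2 L) ->
  exists L1 L2, [/\ L = L1 ++ L2,
                    forall x : {set T} * nat, x \in L1 -> x.2 <= q &
                    forall x : {set T} * nat, x \in L2 -> q < x.2].
Proof.
elim: L => [|x L IH] /=; first by exists [::], [::].
case/andP=> /allP xL /IH[L1 [L2 [eL H1 H2]]].
case: (leqP x.2 q) => xq.
  exists (x :: L1), L2; rewrite eL; split=> // z.
  by rewrite inE => /orP[/eqP->|/H1].
exists [::], (x :: L); split=> // z; rewrite inE => /orP[/eqP->|zL] //.
by apply: leq_trans xq (xL _ _); apply: map_f.
Qed.

Lemma mem_rem_neq (T : eqType) (s : seq T) x y :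
  y \in s -> y != x -> y \in rem x s.
Proof.
move=> ys yx; case: (boolP (x \in s)) => [xs|/rem_id-> //].
by move: ys; rewrite (perm_mem (perm_to_rem xs)) inE (negPf yx).
Qed.

Lemma cover_rem (T : finType) (O : seq {set T}) (X : {set T}) v :
  (exists2 A, A \in O & v \in A) -> v \notin X ->
  exists2 A, A \in rem X O & v \in A.
Proof.
move=> [A AO vA] vX; exists A => //; apply: mem_rem_neq => //.
by apply: contraNneq vX => <-.
Qed.

Lemma sum_spend_unmarked (T : finType) (V Y : {set T}) (g : T -> nat) :
  ~~ (Y \subset V) -> \sum_(v in Y) g v < \sum_(v in Y) spend V g v + #|Y|.
Proof.
move=> YV; apply: leq_ltn_trans (sum_spend V Y g) _; rewrite ltn_add2l.
apply: proper_card; rewrite properE subsetIl.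
by apply: contra YV => /subset_trans; apply; apply: subsetIr.
Qed.

Lemma sum_spend_card (T : finType) (V Y : {set T}) (g : T -> nat) :
  \sum_(v in Y) g v <= \sum_(v in Y) spend V g v + #|Y|.
Proof.
apply: leq_trans (sum_spend V Y g) _.
by rewrite leq_add2l subset_leq_card ?subsetIl.
Qed.

(** * Bob's possible replies *)

(** Removing X frees at least [#|Y|] in (R1) and at least 1 in every S, which pays for all marks. *)
Lemma good_full (T : finType) (e : rel T) m (R V X : {set T}) g O L :
  good e m R g O L -> X \in O -> X \subset V ->
  good e m (R :\: X) (spend V g) (rem X O) L.
Proof.
case=> [HO HL HP HC [H1 H2]] XO XV; split=> //.
- by move=> A /mem_rem; apply: HO.
- move=> v /setDP[/HC[vO vX|vL _]]; last by right.
  by left; apply: cover_rem vX.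
split.
  move=> A Y /mem_rem AO YA Y0; have := H1 A Y AO YA Y0.
  have := sum_spend_card V Y g.
  rewrite (req_rem m L _ XO).
  have := acost_ge #|X| (y := #|Y|); rewrite card_gt0 => /(_ Y0).
  lia.
apply: demand_mono H2 => x v _ _; rewrite (Ssum_rem _ XO) /scost.
have := spend_le V g v; clear; lia.
Qed.

Lemma good_tight (T : finType) (e : rel T) m (R V X Y0 : {set T}) g O L :
  good e m R g O L -> X \in O -> ~~ (X \subset V) ->
  Y0 \subset X -> Y0 \subset V -> Y0 != set0 ->
  \sum_(v in Y0) g v = req m O L #|Y0| ->
  (forall A Y : {set T}, A \in O -> Y \subset A -> Y \subset V ->
     #|Y0| < #|Y| -> req m O L #|Y| < \sum_(v in Y) g v) ->
  exists L', good e m (R :\: (X :&: V)) (spend V g) (rem X O) L'.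
Proof.
case=> [HO HL HP HC [H1 H2]] XO XV Y0X Y0V Y0n Y0t Ymax.
have [Xind /andP[X2 Xm]] := HO X XO.
set y0 := #|Y0|; set k := #|X :&: V|.
have y0p : 0 < y0 by rewrite card_gt0.
have y0k : y0 <= k by apply: subset_leq_card; rewrite subsetI Y0X.
have kX : k < #|X|.
  apply: proper_card; rewrite properE subsetIl.
  by apply: contra XV => /subset_trans; apply; apply: subsetIr.
have cR : #|X :\: V| = #|X| - k by rewrite cardsD.
have y0m : m - (m - y0) = y0.
  by rewrite subKn //; apply: leq_trans y0k (leq_trans (ltnW kX) Xm).
have [L1 [L2 [defL L1q L2q]]] := level_split (m - y0) HP.
exists (L1 ++ (X :\: V, m - y0) :: L2); split.
- by move=> A /mem_rem; apply: HO.
- move=> x; rewrite mem_cat inE orbCA -mem_cat -defL => /orP[/eqP->|].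
    2: exact: HL.
  split; first exact: independent_diff.
  by rewrite /= subn_gt0; lia.
- move: HP; rewrite defL /unzip2 !map_cat !pairwise_cat /=.
  move=> /and3P[H12 HP1 ->].
  rewrite HP1 /= andbT allrel_consr H12 andbT; apply/andP; split.
    by apply/allP => q /mapP[x xL ->]; apply: L1q.
  by apply/allP => q /mapP[x xL ->]; apply: ltnW; apply: L2q.
- move=> v /setDP[vR]; rewrite inE => vXV.
  case: (boolP (v \in X)) vXV => [vX /= vV|vX _].
    right; exists (X :\: V, m - y0); last by rewrite inE vX andbT.
    by rewrite mem_cat mem_head orbT.
  case: (HC v vR) => [vO|[x xL vx]]; first by left; apply: cover_rem vX.
  right; exists x => //; move: xL; rewrite defL !mem_cat inE.
  by move=> /orP[]->; rewrite ?orbT.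
split.
  move=> A Y /mem_rem AO YA Yn; have := H1 A Y AO YA Yn.
  have Yp : 0 < #|Y| by rewrite card_gt0.
  have := req_rem m L #|Y| XO; rewrite req_split -defL /= cR.
  have := acost_tight (ltnW kX) (y0 := y0) (y := #|Y|).
  rewrite y0p y0k => /(_ isT Yp).
  rewrite y0m; move: (_ * minn _ _) => w.
  (* If Y has an unmarked vertex, it loses at most [#|Y|] - 1. If it lies in V and is larger than
     Y0, maximality supplies the unit that [acost_tight] lacks. *)
  case: (boolP (Y \subset V)) => YV; last first.
    have := sum_spend_unmarked g YV; have := leq_b1 (y0 < #|Y|); clear; lia.
  have := sum_spend_card V Y g; case: ltnP => y0Y; last by clear; lia.
  have := Ymax A Y AO YA YV y0Y; clear; lia.
move: H2; rewrite {1}defL !demand_cat /= => -[D1 D2].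
split; last split.
- apply: demand_mono D1 => x v _ _; rewrite (Ssum_rem _ XO) /scost.
  have := spend_le V g v; clear; lia.
- move=> v /setDP[vX vV]; rewrite spend_unmarked // -/y0.
  have vY0 : v \notin Y0 by apply: contra vV; apply: (subsetP Y0V).
  (* Subtracting the tight equality for Y0 leaves g v >= S(y0) + [weight L1]; the bound becomes
     strict because X leaves O. *)
  have := H1 X (v |: Y0) XO; rewrite subUset sub1set vX Y0X => /(_ isT).
  rewrite big_setU1 //= Y0t cardsU1 vY0 add1n -/y0.
  have -> : v |: Y0 != set0 by apply/set0Pn; exists v; rewrite setU11.
  move=> /(_ isT); rewrite {1}defL (req_succ O _ L1q L2q) -?defL; last first.
    by rewrite y0p (leq_trans y0k) // (leq_trans (ltnW kX)).
  rewrite (Ssum_rem _ XO) /scost y0m.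
  clear; lia.
(* The new part delays these by [#|X|] - k, but m - q < y0 <= k, so S(m - q) drops by at least
   [#|X|] - k + 1. *)
- apply: demand_mono D2 => -[A q] v /L2q /= qm _.
  rewrite (Ssum_rem _ XO) /scost cR.
  have := spend_le V g v; clear - y0p y0k kX qm; lia.
Qed.

(** Truncated subtraction: the value is 0 exactly when Y satisfies (R1) after the marking, before
    Bob replies. *)
Definition deficit (T : finType) m (O : seq {set T}) L (V : {set T})
    (g : T -> nat) (Y : {set T}) : nat :=
  req m O L #|Y| - \sum_(v in Y) spend V g v.

(** Shrinking X frees enough to cover the allowed deficits: up to [#|X|] - 2 if two vertices of X
    remain, up to [#|X :&: V|] = [#|X|] - 1 if only one does. The lower bound on [#|X|] makes S drop
    at the level of each marked under part. *)
Lemma good_shrink (T : finType) (e : rel T) m (R V X : {set T}) g O L :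
  good e m R g O L -> X \in O -> ~~ (X \subset V) -> X :&: V != set0 ->
  (forall (x : {set T} * nat) v, x \in L -> v \in x.1 -> v \in V ->
     m - x.2 + 2 <= #|X|) ->
  (forall A Y : {set T}, A \in O -> Y \subset A -> Y != set0 ->
     deficit m O L V g Y <=
     minn #|Y|.-1 (minn #|X|.-1 (maxn (#|X| - 2) #|X :&: V|))) ->
  exists O' L', good e m (R :\: (X :&: V)) (spend V g) O' L'.
Proof.
case=> [HO HL HP HC [H1 H2]] XO XV XVn HX Hdef.
have [Xind /andP[X2 Xm]] := HO X XO.
have SumE := Ssum_rem _ XO.
set k := #|X :&: V| in Hdef *.
have k0 : 0 < k by rewrite card_gt0.
have kX : k < #|X|.
  apply: proper_card; rewrite properE subsetIl.
  by apply: contra XV => /subset_trans; apply; apply: subsetIr.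
have k0X : 0 < k < #|X| by rewrite k0.
have cR : #|X :\: V| = #|X| - k by rewrite cardsD.
have cov v : v \in R :\: (X :&: V) -> v \in X :\: V \/
    ((exists2 A, A \in rem X O & v \in A) \/
     (exists2 x, x \in L & v \in x.1)).
  move=> /setDP[vR]; rewrite !inE; case: (boolP (v \in X)) => [_ ->|vX _].
    by left.
  by right; case: (HC v vR) => [vO|]; [left; apply: cover_rem vX | right].
case: (leqP 2 (#|X| - k)) => r2.
  exists ((X :\: V) :: rem X O), L.
  have SE j : Ssum (X :\: V :: rem X O) j =
              maxn 1 (#|X| - k - j) + Ssum (rem X O) j.
    by rewrite /Ssum big_cons cR.
  split=> //.
  - move=> A; rewrite inE => /orP[/eqP->|/mem_rem]; last exact: HO.
    by rewrite cR; split; [apply: independent_diff | lia].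
  - move=> v /cov[vX|[[A AO vA]|]]; last by right.
      by left; exists (X :\: V); rewrite ?mem_head.
    by left; exists A => //; rewrite inE AO orbT.
  split.
    have H (A Y : {set T}) : A \in O -> Y \subset A -> Y != set0 ->
        req m (X :\: V :: rem X O) L #|Y| <= \sum_(v in Y) spend V g v.
      move=> AO YA Yn; have := Hdef A Y AO YA Yn; rewrite /deficit.
      have Yp : 0 < #|Y| by rewrite card_gt0.
      have -> : req m (X :\: V :: rem X O) L #|Y| =
                acost (#|X| - k) #|Y| + req m (rem X O) L #|Y|.
        by rewrite /req big_cons cR addnA.
      rewrite (req_rem m L _ XO); have := acost_shrink #|Y|.-1 k0X.
      rewrite (prednK Yp); clear - k0X r2 Yp; lia.
    move=> A Y; rewrite inE => /orP[/eqP-> YX|/mem_rem]; last exact: H.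
    by apply: H XO _; apply: subset_trans YX (subsetDl _ _).
  apply: demand_mono H2 => x v xL vx; rewrite SumE SE /scost.
  have := spend_le V g v.
  case: (boolP (v \in V)) => [vV|_] /=; last by clear; lia.
  have := HX x v xL vx vV; clear - kX k0; lia.
exists (rem X O), ((X :\: V, 1) :: L).
have r1 : #|X| - k = 1 by lia.
split=> //.
- by move=> A /mem_rem; apply: HO.
- move=> x; rewrite inE => /orP[/eqP->|]; last exact: HL.
  by split; first exact: independent_diff.
- rewrite /= HP andbT; apply/allP => q /mapP[x xL ->].
  by have [] := HL x xL.
- move=> v /cov[vX|[vO|[x xL vx]]]; [right|by left|right].
    by exists (X :\: V, 1); rewrite ?mem_head.
  by exists x; rewrite // inE xL orbT.
split.
  move=> A Y /mem_rem AO YA Yn; have := Hdef A Y AO YA Yn; rewrite /deficit.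
  have Yp : 0 < #|Y| by rewrite card_gt0.
  (* The singleton adds at most [#|Y|] - 1, while [acost 1 #|Y|] >= [#|Y|] is available for it; the
     spare unit admits a deficit of [#|X|] - 1. *)
  rewrite (req_split m _ [::]) /= cR r1 (req_rem m L _ XO).
  have := acost_shrink #|Y|.-1 k0X; rewrite (prednK Yp) r1.
  have := acost_ge 1 Yp; clear - k0X r1; lia.
split.
  move=> v /setDP[vX vV]; rewrite spend_unmarked // addn0 /=.
  (* (R1) for [[set v]] gives g v >= [size O], and at j = m - 1 each remaining over part counts only
     1 in S. *)
  have := H1 X [set v] XO; rewrite sub1set vX cards1 big_set1 req1.
  have -> : [set v] != set0 by apply/set0Pn; exists v; rewrite set11.
  move=> /(_ isT isT); apply: leq_trans.
  rewrite (perm_size (perm_to_rem XO)) /= ltnS /Ssum -sum1_size !big_seq.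
  by apply: leq_sum => A /mem_rem /HO[_]; rewrite /scost; lia.
apply: demand_mono H2 => x v xL vx; rewrite /= SumE /scost cR r1.
have := spend_le V g v.
case: (boolP (v \in V)) => [vV|_] /=; last by clear; lia.
(* S drops by at least 2: one for the singleton now in front, one for the mark. *)
have := HX x v xL vx vV; clear; lia.
Qed.

(** Parts before A and the rest of A are unmarked; for parts after A, the at least one colored
    vertex of A pays for the mark. In (R1), the bound on [deficit] is exactly what the colored
    vertices contributed. *)
Lemma good_under (T : finType) (e : rel T) m (R V A : {set T}) q g O L1 L2 :
  good e m R g O (L1 ++ (A, q) :: L2) ->
  (forall (x : {set T} * nat) v, x \in L1 -> v \in x.1 -> v \notin V) ->
  A :&: V != set0 ->
  (forall B Y : {set T}, B \in O -> Y \subset B -> Y != set0 ->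
     deficit m O (L1 ++ (A, q) :: L2) V g Y <=
     #|A :&: V| * minn #|Y|.-1 (m - q)) ->
  good e m (R :\: (A :&: V)) (spend V g) O (L1 ++ (A :\: V, q) :: L2).
Proof.
case=> [HO HL HP HC [H1 H2]] HV AVn Hdef.
have t0 : 0 < #|A :&: V| by rewrite card_gt0.
have cA : #|A| = #|A :&: V| + #|A :\: V| by rewrite cardsID.
split=> //.
- move=> x; rewrite mem_cat inE orbCA => /orP[/eqP->|xL].
    have [|Aind q0] := HL (A, q); first by rewrite mem_cat mem_head orbT.
    by split=> //; apply: independent_diff.
  by apply: HL; rewrite mem_cat inE orbCA xL orbT.
- by move: HP; rewrite /unzip2 !map_cat.
- move=> v /setDP[vR]; rewrite inE => vAV.
  case: (HC v vR) => [|[x]]; first by left.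
  rewrite mem_cat inE orbCA => /orP[/eqP-> /= vA|xL vx]; right.
    exists (A :\: V, q); first by rewrite mem_cat mem_head orbT.
    by rewrite inE vA andbT; move: vAV; rewrite vA.
  by exists x; rewrite // mem_cat inE orbCA xL orbT.
split.
  move=> B Y BO YB Yn; have := Hdef B Y BO YB Yn.
  rewrite /deficit !req_split /= cA mulnDl; lia.
move: H2; rewrite !demand_cat /= => -[D1 [DA D2]]; split; last split.
- by apply: demand_mono D1 => x v xL vx; rewrite spend_unmarked ?(HV x).
- by move=> v /setDP[vA vV]; rewrite spend_unmarked //; apply: DA.
- apply: demand_mono D2 => x v xL vx; rewrite cA.
  have := spend_le V g v; lia.
Qed.

(** * Choosing the reply *)

Lemma first_marked (T : finType) (L : seq ({set T} * nat)) (V : {set T}) :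
  (forall (x : {set T} * nat) v, x \in L -> v \in x.1 -> v \notin V) \/
  exists L1 A q L2, [/\ L = L1 ++ (A, q) :: L2, A :&: V != set0 &
    forall (x : {set T} * nat) v, x \in L1 -> v \in x.1 -> v \notin V].
Proof.
elim: L => [|[A q] L IH]; first by left.
case: (boolP (A :&: V == set0)) => [/eqP/setP AV|AV]; last first.
  by right; exists [::], A, q, L.
have HA v : v \in A -> v \notin V.
  by move=> vA; have := AV v; rewrite !inE vA /= => ->.
case: IH => [H|[L1 [B [r [L2 [-> BV H]]]]]]; [left|right].
  by move=> x v; rewrite inE => /orP[/eqP->|/H]; [apply: HA | apply].
exists ((A, q) :: L1), B, r, L2; split=> // x v.
by rewrite inE => /orP[/eqP->|/H]; [apply: HA | apply].
Qed.

(* The under part that Bob considers coloring has t marked vertices and level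
   m - r; t = 0 when no vertex of an under part is marked. *)
Lemma good_shrink_or_small_deficit (T : finType) (e : rel T) m (R V : {set T})
    g O L t r :
  good e m R g O L ->
  (forall A : {set T}, A \in O -> ~~ (A \subset V)) ->
  (forall A Y : {set T}, A \in O -> Y \subset A -> Y != set0 ->
     deficit m O L V g Y <= minn #|Y|.-1 #|Y :&: V|) ->
  (forall (x : {set T} * nat) v, x \in L -> v \in x.1 -> v \in V ->
     0 < t /\ m - x.2 <= r) ->
  (forall A Y : {set T}, A \in O -> Y \subset A -> Y != set0 ->
     deficit m O L V g Y <= t * minn #|Y|.-1 r) \/
  exists (X : {set T}) O' L', [/\ X \subset V, independent e X &
    good e m (R :\: X) (spend V g) O' L'].
Proof.
move=> G notfull Hdef Ht.
pose bad (Y : {set T}) := [&& has (fun A : {set T} => Y \subset A) O, Y != set0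
  & t * minn #|Y|.-1 r < deficit m O L V g Y].
case: (pickP bad) => [Y1 bad1|nobad]; last first.
  left=> A Y AO YA Yn; have := nobad Y; rewrite /bad Yn.
  have -> : has (fun A : {set T} => Y \subset A) O by apply/hasP; exists A.
  by rewrite ltnNge /= => /negbFE.
right.
have [Y2 bad2 max2] := arg_maxnP (fun Y : {set T} => #|Y|) bad1.
have P2 : bad Y2 && (#|Y2| == #|Y2|) by rewrite bad2 eqxx.
have [Y /andP[badY /eqP cY] maxY] := arg_maxnP
  (P := fun Y : {set T} => bad Y && (#|Y| == #|Y2|)) (deficit m O L V g) P2.
move: (badY) => /and3P[/hasP[X XO YX] Yn Ybad].
have dY := Hdef X Y XO YX Yn.
have YVX : #|Y :&: V| <= #|X :&: V| by apply/subset_leq_card/setSI.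
have cYX := subset_leq_card YX.
(* Otherwise the under part would cover t times [#|Y|.-1], at least the deficit of Y. *)
have rY : 0 < t -> r < #|Y|.-1.
  move=> t0; rewrite ltnNge; apply/negP => Yr; move: Ybad.
  rewrite (minn_idPl Yr) ltnNge (leq_trans _ (leq_pmull _ t0)) //.
  by apply: leq_trans dY _; apply: geq_minl.
have [HO _ _ _ _] := G; have [Xind X2] := HO X XO.
exists (X :&: V).
have [|x v xL vx vV|A Z AO ZA Zn|O' [L' G']] :=
    good_shrink (V := V) G XO (notfull X XO); last 1 first.
- by exists O', L'; split; rewrite ?subsetIr //; apply: independent_meet.
- by rewrite -card_gt0; clear - Ybad dY YVX; lia.
- by have [t0 xr] := Ht x v xL vx vV; have := rY t0; clear - cYX xr; lia.
have dZ := Hdef A Z AO ZA Zn.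
(* A smaller Z has deficit at most [#|X|] - 2. A larger or equal Z that is bad has the size of Y and
   at most its deficit, by the choice of Y; one that is not bad has a deficit below that of Y. *)
case: (leqP #|X| #|Z|) => XZ; last by clear - dZ XZ; lia.
case: (boolP (bad Z)) => badZ.
  have Z2 : #|Z| <= #|Y2| := max2 Z badZ.
  have ZY : #|Z| = #|Y2| by clear - Z2 XZ cY cYX; lia.
  have := maxY Z; rewrite badZ ZY eqxx => /(_ isT).
  clear - dY YVX cYX XZ dZ cY Z2; rewrite /geq /=; lia.
move: badZ; rewrite /bad Zn.
have -> : has (fun A : {set T} => Z \subset A) O by apply/hasP; exists A.
rewrite -leqNgt /=; have [->|t0] := posnP t; first by clear; lia.
have -> : minn #|Z|.-1 r = minn #|Y|.-1 r.
  by have := rY t0; clear - XZ cYX; lia.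
move=> /leq_ltn_trans/(_ Ybad).
clear - dY YVX cYX XZ dZ; lia.
Qed.

Lemma good_step (T : finType) (e : rel T) m (R V : {set T}) g O L :
  good e m R g O L -> V \subset R -> V != set0 ->
  exists (X : {set T}) O' L', [/\ X \subset V, independent e X &
    good e m (R :\: X) (spend V g) O' L'].
Proof.
move=> G VR Vn; have [HO HL HP HC [H1 _]] := G.
case: (boolP (has (fun A : {set T} => A \subset V) O)) => [|/hasPn notfull].
  move=> /hasP[X XO XV]; exists X, (rem X O), L.
  by have [Xind _] := HO X XO; split=> //; apply: good_full.
pose tight (Y : {set T}) := [&& has (fun A : {set T} => Y \subset A) O,
  Y \subset V, Y != set0 & \sum_(v in Y) g v == req m O L #|Y|].
have tightI (A Y : {set T}) : A \in O -> Y \subset A -> Y \subset V ->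
    Y != set0 -> ~~ tight Y -> req m O L #|Y| < \sum_(v in Y) g v.
  move=> AO YA YV Yn; rewrite /tight YV Yn /=.
  have -> : has (fun A : {set T} => Y \subset A) O by apply/hasP; exists A.
  by rewrite ltn_neqAle eq_sym (H1 A) // => ->.
case: (pickP tight) => [Y1 tight1|notight].
  have [Y0 /and4P[/hasP[X XO YX] YV Yn /eqP Y0t] maxY] :=
    arg_maxnP (fun Y : {set T} => #|Y|) tight1.
  exists (X :&: V), (rem X O).
  have [|L' G'] := good_tight G XO (notfull X XO) YX YV Yn Y0t.
    move=> A Y AO YA YV' cY; apply: (tightI A) => //.
      by rewrite -card_gt0 (leq_ltn_trans _ cY).
    by apply/negP => /maxY; rewrite /geq /= leqNgt cY.
  have [Xind _] := HO X XO.
  by exists L'; split; rewrite ?subsetIr //; apply: independent_meet.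
(* A set inside V is not tight, so it had a unit to spare; any other set has an unmarked vertex. *)
have Hdef (A Y : {set T}) : A \in O -> Y \subset A -> Y != set0 ->
     deficit m O L V g Y <= minn #|Y|.-1 #|Y :&: V|.
  move=> AO YA Yn; have Yp : 0 < #|Y| by rewrite card_gt0.
  rewrite /deficit; have := H1 A Y AO YA Yn; have := sum_spend V Y g.
  have := subset_leq_card (subsetIl Y V).
  case: (boolP (Y \subset V)) => YV.
    have := tightI A Y AO YA YV Yn; rewrite notight => /(_ isT).
    have := sum_spend_card V Y g; lia.
  have := sum_spend_unmarked g YV; lia.
case: (first_marked L V) => [unmarked|[L1 [A [q [L2 [defL AV unmarked]]]]]].
  have [x v xL vx vV||//] :=
      good_shrink_or_small_deficit (t := 0) (r := 0) G notfull Hdef.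
    by have := unmarked x v xL vx; rewrite vV.
  (* With t = 0 all deficits vanish, so any marked over part can be shrunk. *)
  move=> nodef; have [v vV] := set0Pn _ Vn.
  have [[X XO vX]|[x xL vx]] := HC v (subsetP VR v vV); last first.
    by have := unmarked x v xL vx; rewrite vV.
  exists (X :&: V); have [Xind _] := HO X XO.
  have [|x w xL wx wV|A Y AO YA Yn|O' [L' G']] :=
      good_shrink (V := V) G XO (notfull X XO); last 1 first.
  - by exists O', L'; split; rewrite ?subsetIr //; apply: independent_meet.
  - by apply/set0Pn; exists v; rewrite inE vX.
  - by have := unmarked x w xL wx; rewrite wV.
  - by have := nodef A Y AO YA Yn; rewrite mul0n leqn0 => /eqP->.
have t0 : 0 < #|A :&: V| by rewrite card_gt0.
have [x v|nodef|//] :=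
    good_shrink_or_small_deficit (t := #|A :&: V|) (r := m - q) G notfull Hdef.
  rewrite defL mem_cat inE => /or3P[xL1 vx|/eqP-> //|xL2 _ _].
    by have := unmarked x v xL1 vx => /negPf->.
  (* Levels increase along L, so later under parts have level at least q. *)
  split=> //; apply: leq_sub2l.
  move: HP; rewrite defL /unzip2 map_cat pairwise_cat /=.
  by move=> /and4P[_ _ /allP H _]; apply: H; apply: map_f.
exists (A :&: V), O, (L1 ++ (A :\: V, q) :: L2).
have [|Aind _] := HL (A, q); first by rewrite defL mem_cat mem_head orbT.
split; rewrite ?subsetIr //; first exact: independent_meet.
by apply: good_under; rewrite -?defL.
Qed.

(** * From the invariant to a winning strategy *)

Lemma demand_pos (T : finType) c (g : T -> nat) acc L (x : {set T} * nat) v :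
  demand c g acc L -> x \in L -> v \in x.1 -> 0 < g v.
Proof.
elim: L acc => //= y L IH acc [Hy HL] + vx.
rewrite inE => /orP[/eqP eq_xy|xL]; last exact: IH HL xL vx.
by apply: leq_ltn_trans (Hy v _); rewrite -?eq_xy.
Qed.

Lemma good_pos (T : finType) (e : rel T) m (R : {set T}) g O L v :
  good e m R g O L -> v \in R -> 0 < g v.
Proof.
move=> [_ _ _ HC [H1 H2]] /HC[[A AO vA]|[x xL vx]]; last first.
  exact: demand_pos H2 xL vx.
have := H1 A [set v] AO; rewrite sub1set vA cards1 big_set1 req1.
have -> : [set v] != set0 by apply/set0Pn; exists v; rewrite set11.
by move=> /(_ isT isT); apply: leq_trans; case: (O) AO.
Qed.

Definition residual (T : finType) (f : T -> nat) (h : history T) : T -> nat :=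
  foldl (fun g r => spend r.1 g) f h.

Lemma residualE (T : finType) (f : T -> nat) (h : history T) v :
  residual f h v = f v - marks h v.
Proof.
elim/last_ind: h => [|h r IH]; first by rewrite /marks subn0.
rewrite /residual foldl_rcons -/(residual f h) /spend IH /marks -cats1.
by rewrite count_cat /= addn0 subnDA.
Qed.

Lemma uncolored_rcons (T : finType) (h : history T) r :
  uncolored (rcons h r) = uncolored h :\: r.2.
Proof. by rewrite /uncolored -cats1 big_cat big_seq1 setDE setCU. Qed.

(** A strategy sees only the history, so the lists O and L are not stored: Bob picks any legal
    answer after which suitable lists exist. Positivity of the remaining marks then prevents Alice
    from winning. *)
Lemma good_choosable (T : finType) (e : rel T) m (f : T -> nat) O L :
  good e m [set: T] f O L -> online_choosable e f.
Proof.
move=> G0.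
pose inv h := exists O' L', good e m (uncolored h) (residual f h) O' L'.
have inv0 : inv [::] by exists O, L; rewrite /uncolored big_nil setC0.
pose answers (h : history T) (V X : {set T}) :=
  [&& X \subset V, independent e X & `[< inv (rcons h (V, X)) >]].
pose s (h : history T) (V : {set T}) := odflt set0 [pick X | answers h V X].
have answer h V : inv h -> alice_move h V -> answers h V (s h V).
  move=> [O' [L' G]] /andP[Vn VR]; rewrite /s.
  case: pickP => // noX.
  have [X [O2 [L2 [XV Xind G2]]]] := good_step G VR Vn.
  have := noX X; rewrite /answers XV Xind /= => /negP[].
  apply/asboolP; exists O2, L2.
  by rewrite uncolored_rcons /residual foldl_rcons.
exists s => h V play move_V.
have inv_h : inv h.
  elim: play {V move_V} => // h' V _ inv_h' /(answer _ _ inv_h').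
  by move=> /and3P[_ _ /asboolP].
have /and3P[XV Xind /asboolP[O' [L' G]]] := answer h V inv_h move_V.
split; first by rewrite /bob_move XV.
apply/existsP => -[v /andP[vR]]; apply/negP; rewrite -ltnNge -subn_gt0.
by rewrite -residualE; apply: good_pos G vR.
Qed.

(** * Parts of the graph, and the sums S, alpha and beta *)

(** A maximal independent set containing v must be the whole block of v. *)
Lemma parts_inj (T : finType) (e : rel T) (A B : {set T}) v :
  complete_multipartite e -> A \in parts e -> B \in parts e ->
  v \in A -> v \in B -> A = B.
Proof.
move=> [P /and3P[/eqP covP tiP _] eP].
suff H C : C \in parts e -> v \in C -> C = pblock P v.
  by move=> AP BP vA vB; rewrite (H A AP vA) (H B BP vB).
rewrite inE => /maxsetP[Cind Cmax] vC; apply/esym/Cmax; last first.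
  apply/subsetP => w wC; move/forall_inP: Cind => /(_ v vC)/forall_inP/(_ w wC).
  by rewrite eP negbK => /eqP->; rewrite mem_pblock covP.
apply/forall_inP => x xv; apply/forall_inP => y yv; rewrite eP negbK.
by rewrite !(@same_pblock _ P _ v).
Qed.

Lemma card_verts (T : finType) (e : rel T) (s : seq {set T}) :
  complete_multipartite e -> uniq s -> {subset s <= parts e} ->
  #|verts s| = \sum_(A <- s) #|A|.
Proof.
move=> mult_e; elim: s => [|A s IH] /=; first by rewrite /verts !big_nil cards0.
move=> /andP[As us] sP; rewrite /verts !big_cons -/(verts s) -IH //; last first.
  by move=> B Bs; apply: sP; rewrite inE Bs orbT.
rewrite cardsU; have -> : A :&: verts s = set0; last by rewrite cards0 subn0.
apply/setP => v; rewrite !inE; apply/negP => /andP[vA].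
rewrite /verts; have sP' : {subset s <= parts e}.
  by move=> B Bs; apply: sP; rewrite inE Bs orbT.
have AP : A \in parts e by apply: sP; rewrite mem_head.
elim: s As sP' {us sP IH} => [|B s IH]; first by rewrite big_nil inE.
rewrite inE negb_or big_cons inE => /andP[AB As] sP /orP[vB|].
  case/eqP: AB; apply: (parts_inj mult_e AP _ vA vB).
  by apply: sP; rewrite mem_head.
by apply: IH As _ => C Cs; apply: sP; rewrite inE Cs orbT.
Qed.

Lemma Ssum_over (T : finType) m (over : nat -> {set {set T}}) j :
  (forall p, 2 <= p <= m -> forall A, A \in over p -> #|A| = p) ->
  1 <= j <= m ->
  Ssum [seq A | p <- index_iota 2 m.+1, A <- enum (over p)] j = S_ m over j.
Proof.
move=> Hover /andP[j1 jm]; rewrite /Ssum big_allpairs_dep /=.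
have -> : \sum_(2 <= p < m.+1) \sum_(A <- enum (over p)) scost #|A| j =
          \sum_(2 <= p < m.+1) scost p j * #|over p|.
  apply: eq_big_nat => p pm; rewrite big_enum /= mulnC -sum_nat_const.
  by apply: eq_bigr => A /Hover->.
(* Since j >= 1, [maxn j.+1 2] is [j.+1], the first size with p - j positive. *)
rewrite /S_ (maxn_idPl _) // (@big_cat_nat _ _ _ j.+1) //=; congr (_ + _).
  apply: eq_big_nat => p pj; rewrite /scost; have -> : p - j = 0 by lia.
    by rewrite mul1n.
by apply: eq_big_nat => p pj; rewrite /scost; congr (_ * _); lia.
Qed.

Lemma acost_over (T : finType) m (over : nat -> {set {set T}}) y :
  (forall p, 2 <= p <= m -> forall A, A \in over p -> #|A| = p) ->
  1 <= y <= m ->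
  \sum_(A <- [seq A | p <- index_iota 2 m.+1, A <- enum (over p)]) acost #|A| y
  = alpha m over y.
Proof.
move=> Hover; elim: y => // -[_ _|y IH ym].
  rewrite big_allpairs_dep /=; apply: eq_big_nat => p pm.
  by rewrite big_enum -sum1_card; apply: eq_bigr => A _; rewrite acost1.
rewrite [RHS]/= -/(alpha m over y.+1) -IH; last by lia.
rewrite -(Ssum_over Hover); last by lia.
by rewrite /Ssum -big_split; apply: eq_bigr => A _; rewrite /= acostS.
Qed.

(** Interchange of summation: family p occurs in min(y - 1, m - p) of the increments that make up
    beta(y). *)
Lemma beta_under (T : finType) m (under : nat -> seq {set T}) y :
  (forall p, 1 <= p < m -> #|verts (under p)| = \sum_(A <- under p) #|A|) ->
  1 <= y <= m ->
  \sum_(x <- [seq (A, p) | p <- index_iota 1 m, A <- under p])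
     #|x.1| * minn y.-1 (m - x.2) = beta m under y.
Proof.
move=> Hunder ym; rewrite big_allpairs_dep /=.
have -> : \sum_(1 <= p < m) \sum_(A <- under p) #|A| * minn y.-1 (m - p) =
          \sum_(1 <= p < m) #|verts (under p)| * minn y.-1 (m - p).
  by apply: eq_big_nat => p pm; rewrite -big_distrl /= Hunder.
elim: y ym => // -[_ _|y IH ym].
  by rewrite big1 // => p _; rewrite min0n muln0.
rewrite [RHS]/= -/(beta m under y.+1) -IH; last by lia.
rewrite [X in _ + X](big_nat_widen 1 _ m); last by lia.
rewrite [X in _ + X]big_mkcond -big_split /=; apply: eq_big_nat => p pm.
have -> : m - y.+2 + 1 = m - y.+1 by lia.
case: ltnP => pmy; rewrite ?addn0 -?mulnSr; congr (_ * _); lia.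
Qed.

Lemma demand_block (T : finType) c (g : T -> nat) acc (s : seq {set T}) p :
  (forall i v, i < size s -> v \in nth set0 s i ->
     c p + (acc + \sum_(q < i) #|nth set0 s q|) < g v) ->
  demand c g acc [seq (A, p) | A <- s].
Proof.
elim: s acc => //= A s IH acc H; split.
  by move=> v vA; have := H 0 v isT vA; rewrite big_ord0 addn0.
apply: IH => i v si vi; have := H i.+1 v si vi.
by rewrite big_ord_recl (addnA acc).
Qed.

Lemma demand_levels (T : finType) c (g : T -> nat)
    (under : nat -> seq {set T}) n :
  (forall p i v, 1 <= p < n -> i < size (under p) ->
     v \in nth set0 (under p) i ->
     c p + (\sum_(1 <= r < p) \sum_(A <- under r) #|A| +
            \sum_(q < i) #|nth set0 (under p) q|) < g v) ->
  demand c g 0 [seq (A, p) | p <- index_iota 1 n, A <- under p].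
Proof.
elim: n => // -[_ _|n IH H] //.
have -> : index_iota 1 n.+2 = index_iota 1 n.+1 ++ [:: n.+1].
  by rewrite /index_iota !subn1 -[n.+2.-1]addn1 iotaD.
rewrite map_cat flatten_cat demand_cat /= cats0 add0n; split.
  by apply: IH => p i v pn; apply: H; lia.
rewrite /weight big_allpairs_dep; apply: demand_block => i v.
by apply: H; lia.
Qed.

Lemma pairwise_levels (T : finType) (under : nat -> seq {set T}) (r : seq nat) :
  pairwise leq r ->
  pairwise leq (unzip2 [seq (A, p) | p <- r, A <- under p]).
Proof.
elim: r => //= p r IH /andP[/allP pr /IH rr].
rewrite /unzip2 map_cat pairwise_cat rr -map_comp andbT; apply/andP; split.
  apply/allrelP => _ y /mapP[A _ ->] /mapP[_ /allpairsPdep[q [B [qr _ ->]]] ->].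
  exact: pr.
elim: (under p) => //= A s ->; rewrite andbT.
by apply/allP => _ /mapP[B _ ->] /=.
Qed.

(** * The initial position satisfies the invariant *)

Theorem theorem6 (T : finType) (e : rel T) (m : nat)
    (under : nat -> seq {set T}) (over : nat -> {set {set T}}) (f : T -> nat)
    (simple_e : simple_graph e)
    (multipartite_e : complete_multipartite e)
    (m_ge2 : 2 <= m)
    (alpha_e : independence_number e = m)
    (Pi_e : is_partition_of_parts e m under over)
    (R1 : forall j, 1 <= j <= m ->
       (((alpha m over j + beta m under j)%N%:Z)%:E <= Fmin m over f j)%E)
    (R2 : forall j i, 1 <= j <= m.-1 -> 1 <= i <= size (under j) ->
       forall v, v \in under_part under j i ->
       S_ m over (m - j)
         + \sum_(1 <= p < j) #|verts (under p)|
         + \sum_(1 <= q < i) #|under_part under j q|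
         + 1 <= f v) :
  online_choosable e f.
Proof.
have [perm_parts card_over _] := Pi_e.
set U := [seq A | p <- index_iota 1 m, A <- under p] in perm_parts.
set O := [seq A | p <- index_iota 2 m.+1, A <- enum (over p)] in perm_parts.
have memUO A : (A \in U ++ O) = (A \in parts e).
  by rewrite (perm_mem perm_parts) mem_enum.
have uniqU : uniq U.
  move: (enum_uniq (parts e)).
  by rewrite -(perm_uniq perm_parts) cat_uniq => /andP[].
have underU p A : 1 <= p < m -> A \in under p -> A \in U.
  by move=> pm Ap; apply/allpairsPdep; exists p, A; rewrite mem_index_iota.
have card_under p : 1 <= p < m -> #|verts (under p)| = \sum_(A <- under p) #|A|.
  move=> pm; apply: (card_verts multipartite_e) => [|A Ap]; last first.
    by rewrite -memUO mem_cat (underU p).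
  move: uniqU; rewrite /U.
  have : p \in index_iota 1 m by rewrite mem_index_iota.
  case/splitPr => r1 r2.
  rewrite map_cat flatten_cat cat_uniq /= cat_uniq map_id.
  by case/and3P=> _ _ /and3P[].
have parts_indep A : A \in parts e -> independent e A.
  by rewrite inE => /maxsetp.
pose L := [seq (A, p) | p <- index_iota 1 m, A <- under p].
have O_over A : A \in O -> exists2 p, 2 <= p <= m & A \in over p.
  move=> /allpairsPdep[p [B [pm Bp ->]]]; exists p; last by rewrite -mem_enum.
  by move: pm; rewrite mem_index_iota.
apply: (@good_choosable _ _ m _ O L); split.
- move=> A AO; have [p pm Ap] := O_over A AO; rewrite (card_over p) //.
  by split=> //; apply: parts_indep; rewrite -memUO mem_cat AO orbT.
- move=> _ /allpairsPdep[p [A [pm Ap ->]]] /=; rewrite mem_index_iota in pm.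
  split; last by case/andP: pm.
  by apply: parts_indep; rewrite -memUO mem_cat (underU p).
- apply: pairwise_levels; rewrite -sorted_pairwise ?iota_sorted //.
  exact: leq_trans.
(* By irreflexivity [[set v]] is independent, hence extends to a part containing v. *)
- move=> v _; have [_ irr_e] := simple_e.
  have v_ind : independent e [set v].
    apply/forall_inP => x /set1P->; apply/forall_inP => y /set1P->.
    by rewrite irr_e.
  have [A maxA] := maxset_exists v_ind; rewrite sub1set => vA.
  have : A \in U ++ O by rewrite memUO inE.
  rewrite mem_cat => /orP[|AO]; last by left; exists A.
  move=> /allpairsPdep[p [B [pm Bp eqAB]]]; right; exists (A, p) => //.
  by apply/allpairsPdep; exists p, A; rewrite eqAB.
split.
  move=> A Y AO YA Yn; have [p pm Ap] := O_over A AO.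
  have Ym : 1 <= #|Y| <= m.
    rewrite card_gt0 Yn (leq_trans (subset_leq_card YA)) // (card_over p) //.
    by case/andP: pm.
  rewrite /req acost_over // beta_under //.
  have := R1 _ Ym; have : (Fmin m over f #|Y| <= (\sum_(v in Y) f v)%N%:Z%:E)%E.
    apply: Order.TotalTheory.bigmin_le_cond; rewrite eqxx.
    apply/existsP; exists A.
    rewrite YA andbT (big_rem p) ?inE ?Ap // mem_index_iota; lia.
  move=> le1 le2; have := Order.POrderTheory.le_trans le2 le1.
  by rewrite lee_fin ssrint.lez_nat.
apply: demand_levels => p i v pm ip vi.
have pm' : 1 <= p <= m.-1 by lia.
(* (R2) numbers the parts from 1, [nth] from 0. *)
have := R2 p i.+1 pm' ip v vi; rewrite -Ssum_over //; last by lia.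
have -> : \sum_(1 <= r < p) #|verts (under r)| =
          \sum_(1 <= r < p) \sum_(A <- under r) #|A|.
  by apply: eq_big_nat => r rp; apply: card_under; lia.
have -> : \sum_(1 <= q < i.+1) #|under_part under p q| =
          \sum_(q < i) #|nth set0 (under p) q|.
  by rewrite big_add1 big_mkord.
by rewrite addn1 -addnA.
Qed.
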